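(* The multivariable Krawtchouk polynomials $K_p(n;x;\mathfrak p;N)$ diagonalize the algebras $\mathcal{A}_x=\mathbb{R}[\mathfrak{L}^x_1,\dots,\mathfrak{L}^x_p]$ and $\mathcal{A}_n=\mathbb{R}[\mathfrak{L}^n_1,\dots,\mathfrak{L}^n_p]$. More precisely, for $j=1,2,\dots,p$ the following spectral equations hold: $$\mathfrak{L}^x_j\,K_p(n;x;\mathfrak p;N)=(n_j+n_{j+1}+\cdots+n_p)\,K_p(n;x;\mathfrak p;N),$$ $$\mathfrak{L}^n_j\,K_p(n;x;\mathfrak p;N)=(x_1+x_2+\cdots+x_{p+1-j})\,K_p(n;x;\mathfrak p;N).$$
   Context: Notation: $p\ge1$; for a vector $v\in\mathbb{R}^p$, $|v|=v_1+\cdots+v_p$; $\mathfrak P_1^j=\mathfrak p_1+\cdots+\mathfrak p_j$, $X_1^j=x_1+\cdots+x_j$, $N_1^j=n_1+\cdots+n_j$, with value $0$ for $j=0$; $(a)_k=a(a+1)\cdots(a+k-1)$; $E_{x_i}$ is the shift $x_i\mapsto x_i+1$, $\triangle_{x_i}=E_{x_i}-1$, $\nabla_{x_i}=1-E_{x_i}^{-1}$, and $E_{n_i}$ is the shift $n_i\mapsto n_i+1$. One-variable Krawtchouk polynomials: $k_n(x;\mathfrak p;N)=(-N)_n\,{}_2F_1\!\left[\begin{matrix}-n,\ -x\\ -N\end{matrix};\frac1{\mathfrak p}\right]$, with the denominators of the terminating series cancelled against the prefactor. Multivariable Krawtchouk polynomials, for $n\in\mathbb{N}_0^p$: $$K_p(n;x;\mathfrak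 p;N)=\frac1{(-N)_{|n|}}\prod_{j=1}^p k_{n_j}\!\left(x_j;\frac{\mathfrak p_j}{1-\mathfrak P_1^{j-1}};N-|n|+N_1^j-X_1^{j-1}\right).$$ For $q\ge1$ (variables $x_1,\dots,x_q$, parameters $\mathfrak p_1,\dots,\mathfrak p_q$, $M$) put $$\mathcal{L}_q(x;\mathfrak p;M)=\sum_{1\le i\ne j\le q}\mathfrak p_i\,x_j\,\triangle_{x_i}\nabla_{x_j}+\sum_{i=1}^q\big[\mathfrak p_i(x_i-M)\triangle_{x_i}+(1-\mathfrak p_i)x_i\nabla_{x_i}\big],$$ and for $j=1,\dots,p$ $$\mathfrak{L}^x_j=\mathcal{L}_{p+1-j}\!\left(x_j,\dots,x_p;\frac{\mathfrak p_j}{1-\mathfrak P_1^{j-1}},\frac{\mathfrak p_{j+1}}{1-\mathfrak P_1^{j-1}},\dots,\frac{\mathfrak p_p}{1-\mathfrak P_1^{j-1}};N-X_1^{j-1}\right).$$ Let $\mathfrak b$ be the algebra isomorphism from difference operators in $x$ (coefficients rational in $x,\mathfrak p,N$) to difference operators in $n$ (coefficients rational in $n,\mathfrak p,N$) determined by $\mathfrak b(N)=N$ and, for $1\le k\le p$, $\mathfrak b(x_k)=n_{p+1-k}$, $\mathfrak b(E_{x_k})=E_{n_{p+1-k}}$, $\mathfrak b(\mathfrak p_k)=\dfrac{\mathfrak p_{p+1-k}(1-|\mathfrak p|)}{(1-\mathfrak P_1^{p+1-k})(1-\mathfrak P_1^{p-k})}$. Put $\mathfrak{L}^n_j=\mathfrak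 b(\mathfrak{L}^x_j)$. Conventions: all $\mathfrak p_j\ne0$ and $\mathfrak P_1^j\ne1$ for $j=1,\dots,p$. If $N\notin\mathbb{N}_0$, all $n\in\mathbb{N}_0^p$ are considered; if $N\in\mathbb{N}_0$, only $n\in\mathbb{N}_0^p$ with $|n|\le N$. Terms of $\mathfrak{L}^n_jK_p$ involving an index with a negative component have vanishing coefficient and are taken to be $0$. When $N\in\mathbb{N}_0$ and $|n|=N$, each term of $\mathfrak{L}^n_jK_p$ involving $K_p(k;x;\mathfrak p;N)$ with $|k|=N+1$ (whose coefficient contains the factor $|n|-N$) is interpreted as the limit $N'\to N$ of the corresponding term with $N$ replaced by $N'\notin\mathbb{N}_0$. *)

(* Defs.v *)
From HB Require Import structures.
From mathcomp Require Import all_boot all_order all_algebra.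
From mathcomp Require Import finmap monalg.
From mathcomp Require Import all_classical all_reals all_analysis.

Set Implicit Arguments.
Unset Strict Implicit.
Unset Printing Implicit Defensive.

Import Order.TTheory GRing.Theory Num.Theory.
Import numFieldNormedType.Exports.
Local Open Scope classical_set_scope.
Local Open Scope ring_scope.

(* Indices in 'I_p start at 0: the j-th coordinate of the mathematical text is
   the entry of index j - 1. *)

(* v_1 + ... + v_m *)
Definition psum (V : nmodType) (p : nat) (v : 'rV[V]_p) (m : nat) : V :=
  \sum_(i < p | (i < m)%N) v 0 i.

Definition vsum (V : nmodType) (p : nat) (v : 'rV[V]_p) : V :=
  \sum_(i < p) v 0 i.

Definition rvrev (T : Type) (p : nat) (v : 'rV[T]_p) : 'rV[T]_p :=
  \row_(i < p) v 0 (rev_ord i).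

Section Krawtchouk.
Variable R : realType.

Definition poch (a : R) (k : nat) : R := \prod_(i < k) (a + i%:R).

(* (-N)_n / (-N)_k = (-N + k)_(n - k) for k <= n. *)
Definition krawtchouk1 (n : nat) (x q N : R) : R :=
  \sum_(k < n.+1)
    poch (- n%:R) k * poch (- x) k / k`!%:R * q^-1 ^+ k
    * poch (- N + k%:R) (n - k).

Definition krawtchouk (p : nat) (n : 'rV[nat]_p) (x pp : 'rV[R]_p) (N : R) : R :=
  (poch (- N) (vsum n))^-1 *
  \prod_(j < p)
    krawtchouk1 (n 0 j) (x 0 j) (pp 0 j / (1 - psum pp j))
      (N - (vsum n)%:R + (psum n j.+1)%:R - psum x j).

End Krawtchouk.

Section DifferenceOperators.
Variables (R : realType) (p : nat).

(* A coefficient c(y; pp; N), where y stands for the variables x or n, is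
   represented by its value at every point. *)
Definition coef := 'rV[R]_p -> 'rV[R]_p -> R -> R.

(* The difference operator \sum_nu c_nu E^nu in normal form: finitely many
   shifts nu in Z^p, with c_nu written A@_nu. *)
Definition diffop := {malg coef['rV[int]_p]}.

Definition int_vec (nu : 'rV[int]_p) : 'rV[R]_p := map_mx intr nu.

Definition op_coef (c : coef) : diffop := << c *g 0 >>.
Definition op_shift (nu : 'rV[int]_p) : diffop := << (fun _ _ _ => 1) *g nu >>.
Definition op_const (a : R) : diffop := op_coef (fun _ _ _ => a).

(* (c E^nu)(d E^mu) = c (E^nu d) E^(nu + mu) *)
Definition op_mul (A B : diffop) : diffop :=
  \sum_(nu <- msupp A) \sum_(mu <- msupp B)
    << (fun y pp N => A@_nu y pp N * B@_mu (y + int_vec nu) pp N)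
       *g nu + mu >>.

Definition op_E (i : 'I_p) : diffop := op_shift (delta_mx 0 i).
Definition op_Einv (i : 'I_p) : diffop := op_shift (- delta_mx 0 i).
Definition op_fdiff (i : 'I_p) : diffop := op_E i - op_const 1.
Definition op_bdiff (i : 'I_p) : diffop := op_const 1 - op_Einv i.

Definition coef_var (i : 'I_p) : coef := fun y _ _ => y 0 i.
Definition coef_param (i : 'I_p) : coef := fun _ pp _ => pp 0 i.
Definition coef_size : coef := fun _ _ N => N.

(* The operator L_q in the q = #|S| variables of index in S, with q_ i and M
   substituted for its parameters. *)
Definition Lop (S : {set 'I_p}) (q_ : 'I_p -> coef) (M : coef) : diffop :=
  \sum_(i in S) \sum_(j in S | j != i)
    op_mul (op_coef (fun y pp N => q_ i y pp N * y 0 j))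
           (op_mul (op_fdiff i) (op_bdiff j))
  + \sum_(i in S)
    (op_mul (op_coef (fun y pp N => q_ i y pp N * (y 0 i - M y pp N)))
            (op_fdiff i)
     + op_mul (op_coef (fun y pp N => (1 - q_ i y pp N) * y 0 i))
              (op_bdiff i)).

Definition Lx (j : 'I_p) : diffop :=
  Lop [set i : 'I_p | (j <= i)%N]
      (fun i _ pp _ => pp 0 i / (1 - psum pp j))
      (fun x _ N => N - psum x j).

(* b(pp) as a function of pp; the entry of index k has
   psum pp (rev_ord k).+1 = P_1^(p+1-k') and psum pp (rev_ord k) = P_1^(p-k'),
   where k' = k + 1. *)
Definition param_dual (pp : 'rV[R]_p) : 'rV[R]_p :=
  \row_(k < p) (pp 0 (rev_ord k) * (1 - vsum pp) /
    ((1 - psum pp (rev_ord k).+1) * (1 - psum pp (rev_ord k)))).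

(* Substitution of the images of x, pp, N.  The lemmas bmapD, bmap_mul, bmap_E,
   bmap_var, bmap_param and bmap_size below show that bmap is the algebra
   morphism with the prescribed values on generators. *)
Definition coef_dual (c : coef) : coef :=
  fun n pp N => c (rvrev n) (param_dual pp) N.

Definition bmap (A : diffop) : diffop :=
  \sum_(nu <- msupp A) << coef_dual A@_nu *g rvrev nu >>.

Definition Ln (j : 'I_p) : diffop := bmap (Lx j).

Definition act_x (A : diffop) (pp : 'rV[R]_p) (N : R)
    (f : 'rV[R]_p -> R) (x : 'rV[R]_p) : R :=
  \sum_(nu <- msupp A) A@_nu x pp N * f (x + int_vec nu).

Definition real_index (n : 'rV[nat]_p) : 'rV[R]_p := map_mx (fun m => m%:R) n.
Definition shift_index (n : 'rV[nat]_p) (nu : 'rV[int]_p) : 'rV[int]_p :=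
  map_mx Posz n + nu.

(* Action in n on a family F k N, with the conventions at the boundary.  The
   filter N^' is that of punctured neighbourhoods of N, which for a natural
   number N is also that of N' -> N with N' outside N_0.  For |n| <= N the
   operators Ln j raise |n| by at most 1, so for them the second case occurs
   only if |n| = N and |k| = N + 1. *)
Definition act_n (A : diffop) (pp : 'rV[R]_p) (N : R)
    (F : 'rV[nat]_p -> R -> R) (n : 'rV[nat]_p) : R :=
  \sum_(nu <- msupp A)
    let m := shift_index n nu in
    let k := map_mx absz m in
    let term N' := A@_nu (real_index n) pp N' * F k N' in
    if ~~ [forall i, 0 <= m 0 i] then 0
    else if (N \is a Num.nat) && (N < (vsum k)%:R) then lim (term @ N^')
    else term N.

Definition admissible (N : R) (n : 'rV[nat]_p) : Prop :=
  N \is a Num.nat -> (vsum n)%:R <= N.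

(* The algebra R[L_1, ..., L_p]. *)
Inductive in_algebra (L : 'I_p -> diffop) : diffop -> Prop :=
| in_algebra_const a : in_algebra L (op_const a)
| in_algebra_gen j : in_algebra L (L j)
| in_algebra_add A B :
    in_algebra L A -> in_algebra L B -> in_algebra L (A + B)
| in_algebra_mul A B :
    in_algebra L A -> in_algebra L B -> in_algebra L (op_mul A B).

End DifferenceOperators.

Section DifferenceOperatorFacts.
Variables (R : realType) (p : nat).
Implicit Types (A B : diffop R p) (c d : coef R p) (nu mu : 'rV[int]_p).

Lemma sum_msuppw (V : zmodType) (F : 'rV[int]_p -> coef R p -> V) A
    (D : {fset 'rV[int]_p}) :
    (forall nu, F nu 0 = 0) -> fsubset (msupp A) D ->
  \sum_(nu <- msupp A) F nu A@_nu = \sum_(nu <- D) F nu A@_nu.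
Proof.
move=> F0 AD; apply: (big_fset_incl _ AD) => nu _ nuA.
by rewrite mcoeff_outdom.
Qed.

Lemma sum_msuppD (V : zmodType) (F : 'rV[int]_p -> coef R p -> V) A B :
    (forall nu c d, F nu (c + d) = F nu c + F nu d) ->
  \sum_(nu <- msupp (A + B)) F nu (A + B)@_nu =
  \sum_(nu <- msupp A) F nu A@_nu + \sum_(nu <- msupp B) F nu B@_nu.
Proof.
move=> FD; have F0 nu : F nu 0 = 0.
  by apply: (addIr (F nu 0)); rewrite -FD !add0r.
have AD := fsubsetUl (msupp A) (msupp B).
have BD := fsubsetUr (msupp A) (msupp B).
rewrite (sum_msuppw F0 (msuppD_le A B)) (sum_msuppw F0 AD).
rewrite (sum_msuppw F0 BD) -big_split /=.
by apply: eq_bigr => nu _; rewrite mcoeffD FD.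
Qed.

Lemma sum_msuppU (V : zmodType) (F : 'rV[int]_p -> coef R p -> V) nu c :
    (forall nu, F nu 0 = 0) ->
  \sum_(mu <- msupp << c *g nu >>) F mu << c *g nu >>@_mu = F nu c.
Proof.
move=> F0; have cD : fsubset (msupp << c *g nu >>) [fset nu]%fset := msuppU_le.
rewrite (sum_msuppw F0 cD).
by rewrite big_seq_fset1 mcoeffUU.
Qed.

Lemma op_mulDl A A' B : op_mul (A + A') B = op_mul A B + op_mul A' B.
Proof.
rewrite /op_mul.
apply: (@sum_msuppD _ (fun nu c => \sum_(mu <- msupp B)
  << (fun y pp N => c y pp N * B@_mu (y + int_vec R nu) pp N) *g nu + mu >>)).
move=> nu c d; rewrite -big_split /=; apply: eq_bigr => mu _.
rewrite -monalgUD; congr (<< _ *g _ >>).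
by apply/funext => y; apply/funext => pp; apply/funext => N; exact: mulrDl.
Qed.

Lemma op_mulDr A B B' : op_mul A (B + B') = op_mul A B + op_mul A B'.
Proof.
rewrite /op_mul -big_split /=; apply: eq_bigr => nu _.
apply: (@sum_msuppD _ (fun mu c =>
  << (fun y pp N => A@_nu y pp N * c (y + int_vec R nu) pp N) *g nu + mu >>)).
move=> mu c d; rewrite -monalgUD; congr (<< _ *g _ >>).
by apply/funext => y; apply/funext => pp; apply/funext => N; exact: mulrDr.
Qed.

Lemma op_mulUU nu mu c d :
  op_mul << c *g nu >> << d *g mu >> =
  << (fun y pp N => c y pp N * d (y + int_vec R nu) pp N) *g nu + mu >>.
Proof.
have E0 k : << (fun _ _ _ => 0) *g k >> = 0 :> diffop R p.
  exact: monalgU0.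
rewrite /op_mul (@sum_msuppU _ (fun nu0 c0 => \sum_(mu0 <- msupp << d *g mu >>)
  << (fun y pp N => c0 y pp N * << d *g mu >>@_mu0 (y + int_vec R nu0) pp N)
     *g nu0 + mu0 >>)).
  apply: (@sum_msuppU _ (fun mu0 d0 =>
   << (fun y pp N => c y pp N * d0 (y + int_vec R nu) pp N) *g nu + mu0 >>)).
  move=> k; rewrite -(E0 (nu + k)); congr (<< _ *g _ >>).
  by apply/funext => y; apply/funext => pp; apply/funext => N; exact: mulr0.
move=> k; apply: big1 => l _; rewrite -(E0 (k + l)); congr (<< _ *g _ >>).
by apply/funext => y; apply/funext => pp; apply/funext => N; exact: mul0r.
Qed.

Lemma act_xD A B pp N f x :
  act_x (A + B) pp N f x = act_x A pp N f x + act_x B pp N f x.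
Proof.
apply: (@sum_msuppD _ (fun nu c => c x pp N * f (x + int_vec R nu))) => nu c d.
exact: mulrDl.
Qed.

Lemma act_xU nu c pp N f x :
  act_x << c *g nu >> pp N f x = c x pp N * f (x + int_vec R nu).
Proof.
apply: (@sum_msuppU _ (fun nu c => c x pp N * f (x + int_vec R nu))) => k.
exact: mul0r.
Qed.

Lemma act_x_mul A B pp N f x :
  act_x (op_mul A B) pp N f x = act_x A pp N (act_x B pp N f) x.
Proof.
have act_x0 g y : act_x 0 pp N g y = 0.
  by rewrite /act_x msupp0 big_seq_fset0.
have act_xs (I : Type) (r : seq I) (F : I -> diffop R p) g y :
    act_x (\sum_(i <- r) F i) pp N g y = \sum_(i <- r) act_x (F i) pp N g y.
  by elim/big_ind2: _ => // A1 s1 A2 s2 <- <-; rewrite act_xD.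
rewrite /op_mul act_xs [RHS]/act_x; apply: eq_bigr => nu _.
rewrite act_xs /act_x mulr_sumr; apply: eq_bigr => mu _.
rewrite -[LHS]/(act_x _ _ _ _ _) act_xU mulrA; congr (_ * f _).
by rewrite /int_vec map_mxD addrA.
Qed.

Lemma rvrevD (V : nmodType) (u v : 'rV[V]_p) : rvrev (u + v) = rvrev u + rvrev v.
Proof. by apply/rowP => i; rewrite !mxE. Qed.

Lemma rvrevK (T : Type) : involutive (@rvrev T p).
Proof. by move=> v; apply/rowP => i; rewrite !mxE rev_ordK. Qed.

Lemma rvrev_int_vec nu : int_vec R (rvrev nu) = rvrev (int_vec R nu).
Proof. by apply/rowP => i; rewrite !mxE. Qed.

Lemma bmapD A B : bmap (A + B) = bmap A + bmap B.
Proof.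
apply: (@sum_msuppD _ (fun nu c => << coef_dual c *g rvrev nu >>)) => nu c d.
by rewrite -monalgUD.
Qed.

Lemma bmapU nu c : bmap << c *g nu >> = << coef_dual c *g rvrev nu >>.
Proof.
apply: (@sum_msuppU _ (fun nu c => << coef_dual c *g rvrev nu >>)) => k.
exact: monalgU0.
Qed.

Lemma bmap_mul A B : bmap (op_mul A B) = op_mul (bmap A) (bmap B).
Proof.
have sumE (f : diffop R p -> diffop R p) : (forall a b, f (a + b) = f a + f b) ->
    forall (r : seq 'rV[int]_p) (F : 'rV[int]_p -> diffop R p),
    f (\sum_(i <- r) F i) = \sum_(i <- r) f (F i).
  move=> fD r F; have f0 : f 0 = 0 by apply: (addIr (f 0)); rewrite -fD !add0r.
  by elim/big_ind2: _ => // A1 s1 A2 s2 <- <-.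
rewrite [in LHS]/op_mul (sumE _ bmapD) [bmap A]/bmap.
rewrite (sumE (fun X => op_mul X (bmap B))); last by move=> a b; exact: op_mulDl.
apply: eq_bigr => nu _; rewrite (sumE _ bmapD) [bmap B]/bmap.
rewrite (sumE _ (op_mulDr _)); apply: eq_bigr => mu _.
rewrite bmapU op_mulUU rvrevD; congr (<< _ *g _ >>).
apply/funext => y; apply/funext => pp; apply/funext => N.
by rewrite /coef_dual rvrevD rvrev_int_vec rvrevK.
Qed.

Lemma bmap_var (k : 'I_p) :
  bmap (op_coef (coef_var k)) = op_coef (coef_var (rev_ord k) : coef R p).
Proof.
rewrite bmapU; congr (<< _ *g _ >>); first by apply/rowP => i; rewrite !mxE.
by apply/funext => y; apply/funext => pp; apply/funext => N;
  rewrite /coef_dual /coef_var mxE.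
Qed.

Lemma bmap_E (k : 'I_p) : bmap (op_E R k) = op_E R (rev_ord k).
Proof.
rewrite bmapU; congr (<< _ *g _ >>); apply/rowP => i.
by rewrite !mxE !eqxx (can2_eq rev_ordK rev_ordK).
Qed.

Lemma bmap_param (k : 'I_p) :
  bmap (op_coef (coef_param k)) =
  op_coef (fun (_ pp : 'rV[R]_p) (_ : R) => pp 0 (rev_ord k) * (1 - vsum pp) /
    ((1 - psum pp (p - k)) * (1 - psum pp (p - k.+1)))).
Proof.
rewrite bmapU; congr (<< _ *g _ >>); first by apply/rowP => i; rewrite !mxE.
apply/funext => y; apply/funext => pp; apply/funext => N.
by rewrite /coef_dual /coef_param mxE /= subnSK.
Qed.

Lemma bmap_size : bmap (op_coef (@coef_size R p)) = op_coef (@coef_size R p).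
Proof.
by rewrite bmapU; congr (<< _ *g _ >>); apply/rowP => i; rewrite !mxE.
Qed.

End DifferenceOperatorFacts.

(* Main.v *)
Require Import Defs.
From HB Require Import structures.
From mathcomp Require Import all_boot all_order all_algebra.
From mathcomp Require Import finmap monalg.
From mathcomp Require Import all_classical all_reals all_analysis.
From mathcomp Require Import ring zify.

Set Implicit Arguments.
Unset Strict Implicit.
Unset Printing Implicit Defensive.

Import Order.TTheory GRing.Theory Num.Theory.
Import numFieldNormedType.Exports.
Local Open Scope ring_scope.

(** Both families of spectral equations come from first order identities.

    In one variable, Pascal's rule gives
      k_(n+1)(x; M) = (n - M) k_n(x; M) + (x / q) k_n(x - 1; M - 1)
    ([krawtchouk1S]), from which four contiguous relations follow by induction
    on n: one averages over x and x + 1, one lowers x, one raises n and one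
    lowers n; each of them changes M by one.  A product of Krawtchouk
    polynomials as in the definition of K_p splits into a factor in its first
    variables and a factor in its last ones ([kprod_split]); peeling off one
    variable at a time extends the four relations to products of any length
    ([kprod_p_avg], [kprod_lower_x], [kprod_raise_n], [kprod_lower_n]).  Their
    right-hand sides involve only the values of the product at M and M +- 1.

    The second order operator L_q is a combination of a sum of raising shifts,
    a sum of lowering shifts and the composite of these two sums
    ([act_Lop]), because the missing diagonal terms E_i E_i^-1 = 1 can be added
    for free.  Hence two of the relations suffice to compute L_q on a product:
    averaging and lowering x give the equation in x ([kprod_spectral_x]),
    raising and lowering n the one in n ([kprod_spectral_n]).  Since L_j^x
    involves only x_j, ..., x_p, and L_j^n only n_1, ..., n_(p+1-j), each of
    them acts on a single factor of a splitting of K_p.  For the operators in n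
    this uses that the image of the parameters under b, divided as in the
    definition of L_j^n, depends on p_1, ..., p_(p+1-j) only ([act_Ln]).

    The equation in n is first proved when N is not a natural number.  Each
    term of the action on the index at N is the limit, as N' tends to N, of the
    corresponding term at N' ([act_n_cvg]), so that the equation at N follows by
    continuity ([act_n_eigen]).  The limits exist for every operator of the
    algebra, since its coefficients are polynomial in N', do not lead out of
    the nonnegative indices, and at N' = N do not lead from |n| <= N to
    |n| > N; these properties are stable under products ([tame]). *)

(** * One-variable Krawtchouk polynomials *)

Section OneVariable.
Variable R : realType.
Implicit Types (n k : nat) (a x q M : R).

Lemma poch0 a : poch a 0 = 1.
Proof. by rewrite /poch big_ord0. Qed.

Lemma pochSr a k : poch a k.+1 = poch a k * (a + k%:R).
Proof. by rewrite /poch big_ord_recr. Qed.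

Lemma pochS a k : poch a k.+1 = a * poch (a + 1) k.
Proof.
rewrite /poch big_ord_recl addr0; congr (_ * _); apply: eq_bigr => i _.
by rewrite lift0 -addrA -[i.+1]add1n natrD.
Qed.

Lemma poch_oppn n k : poch (- n%:R) k = (-1) ^+ k * (n ^_ k)%:R :> R.
Proof.
elim: k => [|k IH]; first by rewrite poch0 ffactn0 expr0 mulr1.
rewrite pochSr IH ffactnSr natrM exprS.
have [kn|nk] := leqP k n; first by rewrite natrB //; ring.
by rewrite ffact_small ?mulr0n ?mul0r ?mulr0 ?mul0r.
Qed.

Lemma poch_oppn_fact n k : poch (- n%:R) k / k`!%:R = (-1) ^+ k * 'C(n, k)%:R :> R.
Proof.
rewrite poch_oppn -bin_ffact natrM mulrA mulfK ?pnatr_eq0 -?lt0n ?fact_gt0 //.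
Qed.

Let u x q k : R := (-1) ^+ k * q^-1 ^+ k * poch (- x) k.

(** The coefficients (-n)_k / k! are signed binomials, so that Pascal's rule
    applies. *)
Lemma krawtchouk1E n x q M :
  krawtchouk1 n x q M =
  \sum_(k < n.+1) 'C(n, k)%:R * (u x q k * poch (- M + k%:R) (n - k)).
Proof.
apply: eq_bigr => k _; have := poch_oppn_fact n k.
rewrite /u => e; rewrite (mulrAC (poch _ _)) e; ring.
Qed.

Lemma krawtchouk1_0 x q M : krawtchouk1 0 x q M = 1.
Proof. by rewrite krawtchouk1E big_ord1 /u bin0 !expr0 !poch0 !mulr1. Qed.

(** Pascal's rule splits the sum in two.  In the first half (-M + k)_(n - k) has
    acquired the last factor n - M, which is free of k; in the second half the
    first factor of (-x)_(k+1) comes out and leaves the sum for x - 1 and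
    M - 1. *)
Lemma krawtchouk1S n x q M :
  krawtchouk1 n.+1 x q M =
  (n%:R - M) * krawtchouk1 n x q M
  + x / q * krawtchouk1 n (x - 1) q (M - 1).
Proof.
rewrite !krawtchouk1E big_ord_recl /= bin0.
under eq_bigr => i _ do rewrite /bump /= add1n binS natrD mulrDl.
rewrite big_split /= addrA; congr (_ + _).
  pose g k := 'C(n, k)%:R * (u x q k * poch (- M + k%:R) (n.+1 - k)).
  transitivity (\sum_(k < n.+2) g k).
    by rewrite [RHS]big_ord_recl /g bin0.
  rewrite big_ord_recr /g /= bin_small // mul0r addr0 mulr_sumr.
  apply: eq_bigr => -[k /= kn] _; rewrite subSn // pochSr natrB //.
  ring.
rewrite mulr_sumr; apply: eq_bigr => -[k /= kn] _.
rewrite subSS /u !exprS pochS.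
rewrite (_ : - M + k.+1%:R = - (M - 1) + k%:R); last by rewrite -natr1; ring.
rewrite (_ : - x + 1 = - (x - 1)); last by ring.
ring.
Qed.

(** In probabilistic terms: averaging over the outcome of one more Bernoulli
    trial of parameter q undoes the passage from M to M + 1 trials. *)
Lemma krawtchouk1_p_avg n x q M (q0 : q != 0) :
  q * krawtchouk1 n (x + 1) q (M + 1) + (1 - q) * krawtchouk1 n x q (M + 1)
  = krawtchouk1 n x q M.
Proof.
elim: n x M => [|n IH] x M; first by rewrite !krawtchouk1_0; ring.
have IH1 := IH x M; have IH2 := IH (x - 1) (M - 1).
rewrite !krawtchouk1S !addrK -[in RHS]IH2 !subrK.
rewrite -[in RHS]IH1.
set a := krawtchouk1 n (x + 1) _ _; set b := krawtchouk1 n x q (M + 1).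
rewrite -/a -/b in IH1; rewrite -IH1.
by field.
Qed.

Lemma krawtchouk1_lower_x n x q M :
  (M - x) * krawtchouk1 n x q (M - 1) + x * krawtchouk1 n (x - 1) q (M - 1)
  = (M - n%:R) * krawtchouk1 n x q M.
Proof.
elim: n x M => [|n IH] x M; first by rewrite !krawtchouk1_0; ring.
have IH1 := IH x M; have IH2 := IH (x - 1) (M - 1).
rewrite !krawtchouk1S -natr1.
transitivity ((n%:R - M + 1) * ((M - n%:R) * krawtchouk1 n x q M)
   + x / q * ((M - 1 - n%:R) * krawtchouk1 n (x - 1) q (M - 1))); last by ring.
rewrite -IH1 -IH2; ring.
Qed.

(** This is [krawtchouk1_lower_x] with the value at x - 1 eliminated by means of
    [krawtchouk1S]. *)
Lemma krawtchouk1_raise_n n x q M (q0 : q != 0) :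
  q * krawtchouk1 n.+1 x q M
  = (1 - q) * (M - n%:R) * krawtchouk1 n x q M
    + (x - M) * krawtchouk1 n x q (M - 1).
Proof.
have e := krawtchouk1_lower_x n x q M.
transitivity (q * (n%:R - M) * krawtchouk1 n x q M
              + x * krawtchouk1 n (x - 1) q (M - 1)).
  by rewrite krawtchouk1S; field.
apply/eqP; rewrite -subr_eq0; move/eqP: e; rewrite -subr_eq0 => /eqP <-.
by apply/eqP; ring.
Qed.

Lemma krawtchouk1_lower_n n x q M :
  krawtchouk1 n x q (M - 1) - krawtchouk1 n x q M
  = n%:R * krawtchouk1 n.-1 x q (M - 1).
Proof.
elim: n x M => [|n IH] x M; first by rewrite !krawtchouk1_0 subrr mul0r.
have IH1 := IH x M; have IH2 := IH (x - 1) (M - 1).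
rewrite /=; rewrite !krawtchouk1S.
transitivity ((n%:R - M) * (krawtchouk1 n x q (M - 1) - krawtchouk1 n x q M)
  + krawtchouk1 n x q (M - 1) +
  x / q * (krawtchouk1 n (x - 1) q (M - 1 - 1) - krawtchouk1 n (x - 1) q (M - 1))).
  ring.
rewrite IH1 IH2.
case: n {IH IH1 IH2} => [|n]; first by ring.
rewrite /= [in X in _ + X + _]krawtchouk1S [in RHS]krawtchouk1S -!natr1; ring.
Qed.

End OneVariable.

(** * Sums and shifts over a segment of indices *)

Section Segments.
Variable p : nat.

Lemma big_segment_split (V : Type) (idx : V) (op : Monoid.com_law idx) (m s t : nat)
    (F : 'I_p -> V) : (m <= s <= t)%N ->
  \big[op/idx]_(i < p | (m <= i < t)%N) F i =
  op (\big[op/idx]_(i < p | (m <= i < s)%N) F i)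
     (\big[op/idx]_(i < p | (s <= i < t)%N) F i).
Proof.
move=> mst; rewrite (bigID (fun i : 'I_p => (i < s)%N)) /=.
by congr (op _ _); apply: eq_bigl => i; lia.
Qed.

Lemma big_segment1 (V : Type) (idx : V) (op : Monoid.com_law idx) (i : 'I_p)
    (F : 'I_p -> V) :
  \big[op/idx]_(j < p | (i <= j < i.+1)%N) F j = F i.
Proof. by rewrite (big_pred1 i) // => j; rewrite /= -val_eqE /=; lia. Qed.

Lemma big_segmentS (V : Type) (idx : V) (op : Monoid.com_law idx) (i : 'I_p) (t : nat)
    (F : 'I_p -> V) : (i < t)%N ->
  \big[op/idx]_(j < p | (i <= j < t)%N) F j =
  op (F i) (\big[op/idx]_(j < p | (i.+1 <= j < t)%N) F j).
Proof.
by move=> it; rewrite (@big_segment_split _ _ _ _ i.+1) ?leqnSn // big_segment1.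
Qed.

(** Segments grow at their lower end because, in a product of Krawtchouk
    polynomials, all factors after the first depend on the first variables
    only through the parameter M. *)
Lemma segment_ind (t : nat) (Q : nat -> Prop) : (t <= p)%N ->
  Q t -> (forall i : 'I_p, (i < t)%N -> Q i.+1 -> Q i) ->
  forall m, (m <= t)%N -> Q m.
Proof.
move=> tp Qt QS m mt; rewrite -(subKn mt); elim: (t - m)%N (leq_subr m t) => [|d IH] dt.
  by rewrite subn0.
have ip : (t - d.+1 < p)%N by lia.
have := QS (Ordinal ip) => /=; rewrite -subSn // subSS; apply; first by lia.
by apply: IH; lia.
Qed.

Definition segsum (V : nmodType) (v : 'rV[V]_p) (m t : nat) : V :=
  \sum_(i < p | (m <= i < t)%N) v 0 i.

Lemma segsum_nil (V : nmodType) (v : 'rV[V]_p) m : segsum v m m = 0.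
Proof. by apply: big_pred0 => i; lia. Qed.

Lemma segsum_split (V : nmodType) (v : 'rV[V]_p) m s t : (m <= s <= t)%N ->
  segsum v m t = segsum v m s + segsum v s t.
Proof. exact: big_segment_split. Qed.

Lemma segsumS (V : nmodType) (v : 'rV[V]_p) (i : 'I_p) t : (i < t)%N ->
  segsum v i t = v 0 i + segsum v i.+1 t.
Proof. exact: big_segmentS. Qed.

Lemma eq_segsum (V : nmodType) (v w : 'rV[V]_p) m t :
  (forall i : 'I_p, (m <= i < t)%N -> v 0 i = w 0 i) -> segsum v m t = segsum w m t.
Proof. exact: eq_bigr. Qed.

(** The shifts of an index.  If n_i = 0 then [dec n i] is n itself; the value
    of a function there is irrelevant since it always comes with the factor
    n_i. *)
Definition inc (n : 'rV[nat]_p) (i : 'I_p) : 'rV[nat]_p :=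
  \row_l (n 0%R l + (l == i))%N.
Definition dec (n : 'rV[nat]_p) (i : 'I_p) : 'rV[nat]_p :=
  \row_l (n 0%R l - (l == i))%N.

Lemma segsum_inc (n : 'rV[nat]_p) (i : 'I_p) m t : (m <= i < t)%N ->
  segsum (inc n i) m t = (segsum n m t).+1.
Proof.
move=> mit; rewrite /segsum (bigD1 i) //= [in RHS](bigD1 i) //= mxE eqxx addn1.
rewrite (eq_bigr (fun j => n 0 j)) // => j /andP[_ /negPf ji].
by rewrite mxE ji addn0.
Qed.

Lemma inc_dec (n : 'rV[nat]_p) (i : 'I_p) : (0 < n 0%R i)%N -> inc (dec n i) i = n.
Proof.
move=> n0; apply/rowP => l; rewrite !mxE; case: eqVneq => [->|_] /=; lia.
Qed.

Lemma segsum_dec (n : 'rV[nat]_p) (i : 'I_p) m t : (m <= i < t)%N -> (0 < n 0%R i)%N ->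
  segsum n m t = (segsum (dec n i) m t).+1.
Proof. by move=> mit n0; rewrite -{1}(inc_dec n0) segsum_inc. Qed.

End Segments.

(** * Contiguous relations for products of Krawtchouk polynomials *)

Section Products.
Variables (R : realType) (p : nat) (pp : 'rV[R]_p).
Implicit Types (n : 'rV[nat]_p) (x : 'rV[R]_p) (M : R) (m s t : nat) (i j l : 'I_p).

Definition cosum m : R := 1 - psum pp m.

Hypothesis hpp : forall j, pp 0 j != 0.
Hypothesis hpsum : forall j, psum pp j.+1 != 1.

Lemma psum0 (v : 'rV[R]_p) : psum v 0 = 0.
Proof. by apply: big_pred0. Qed.

Lemma psumS (v : 'rV[R]_p) i : psum v i.+1 = psum v i + v 0 i.
Proof.
rewrite /psum (bigD1 i) //= addrC; congr (_ + _); apply: eq_bigl => j.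
by rewrite -val_eqE /=; lia.
Qed.

Lemma cosum0 : cosum 0 = 1.
Proof. by rewrite /cosum psum0 subr0. Qed.

Lemma cosumS i : cosum i.+1 = cosum i - pp 0 i.
Proof. by rewrite /cosum psumS; ring. Qed.

Lemma cosum_neq0 m : (m <= p)%N -> cosum m != 0.
Proof.
case: m => [|m] mp; first by rewrite cosum0 oner_neq0.
by rewrite subr_eq0 eq_sym (hpsum (Ordinal mp)).
Qed.

Let cosum_ord i : cosum i != 0. Proof. exact/cosum_neq0/ltnW. Qed.
Let cosum_ordS i : cosum i.+1 != 0. Proof. exact: cosum_neq0. Qed.

(** The part m <= j < t of the product in the definition of K_p, without the
    normalizing factor, when M trials are left for these variables. *)
Definition kprod m t n x M : R :=
  \prod_(j < p | (m <= j < t)%N)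
    krawtchouk1 (n 0 j) (x 0 j) (pp 0 j / cosum j)
      (M - (segsum n j.+1 t)%:R - segsum x m j).

Lemma kprod_nil m n x M : kprod m m n x M = 1.
Proof. by apply: big_pred0 => j; lia. Qed.

Lemma eq_kprod m t n n' x x' M :
  (forall l, (m <= l < t)%N -> n 0 l = n' 0 l) ->
  (forall l, (m <= l < t)%N -> x 0 l = x' 0 l) ->
  kprod m t n x M = kprod m t n' x' M.
Proof.
move=> nn' xx'; apply: eq_bigr => j mjt; rewrite nn' ?xx' //.
rewrite (@eq_segsum _ _ n n'); last by move=> l ml; apply: nn'; lia.
by rewrite (@eq_segsum _ _ x x') // => l ml; apply: xx'; lia.
Qed.

(** The first factor sees the later variables only through the sum of their n,
    the second one the earlier variables only through the sum of their x.  This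
    is what makes L_j^x and L_j^n act on one factor each. *)
Lemma kprod_split m s t n x M : (m <= s <= t)%N ->
  kprod m t n x M =
  kprod m s n x (M - (segsum n s t)%:R) * kprod s t n x (M - segsum x m s).
Proof.
move=> mst; rewrite /kprod (@big_segment_split _ _ _ _ _ s) //=.
congr (_ * _); apply: eq_bigr => j /andP[mj jt]; congr krawtchouk1.
  rewrite (@segsum_split _ _ n j.+1 s t); last by lia.
  by rewrite natrD; ring.
by rewrite (@segsum_split _ _ x m s j); [ring|lia].
Qed.

Lemma kprodS i t n x M : (i < t)%N ->
  kprod i t n x M =
  krawtchouk1 (n 0 i) (x 0 i) (pp 0 i / cosum i) (M - (segsum n i.+1 t)%:R)
  * kprod i.+1 t n x (M - x 0 i).
Proof.
move=> it; rewrite (@kprod_split _ i.+1) ?leqnSn //.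
rewrite {1}/kprod !big_segment1 !segsum_nil !subr0.
by rewrite /segsum big_segment1.
Qed.

(** The term at the peeled index and the others both contain the remaining
    product at M - x_i, by induction, and their coefficients add up according
    to the one-variable relation for q = p_i / (1 - P_1^(i-1)). *)
Lemma kprod_p_avg m t n x M : (m <= t <= p)%N ->
  \sum_(l < p | (m <= l < t)%N) pp 0 l * kprod m t n (x + delta_mx 0 l) (M + 1)
  + cosum t * kprod m t n x (M + 1) = cosum m * kprod m t n x M.
Proof.
case/andP => mt tp; move: m mt n x M; apply: (segment_ind tp) => [|i it IH] n x M.
  by rewrite big_pred0 => [|l]; [rewrite !kprod_nil add0r|lia].
rewrite big_segmentS //= !kprodS // !mxE !eqxx /=.
under eq_bigr => l /andP[il lt].
  rewrite kprodS // !mxE (_ : (i == l) = false) ?mulr0n ?addr0; last first.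
    by apply/eqP => il'; move: il; rewrite il' ltnn.
  rewrite mulrCA; over.
rewrite -mulr_sumr -addrA [cosum t * _]mulrCA -mulrDr [M + 1 - x 0 i]addrAC IH.
rewrite (@eq_kprod _ _ n n (x + delta_mx 0 i) x) //; last first.
  move=> l il; rewrite !mxE (_ : (l == i) = false) ?mulr0n ?addr0 //.
  by apply/eqP => il'; move: il; rewrite il' ltnn.
rewrite (_ : M + 1 - (x 0 i + 1) = M - x 0 i); last by ring.
have := @krawtchouk1_p_avg R (n 0 i) (x 0 i) (pp 0 i / cosum i)
  (M - (segsum n i.+1 t)%:R).
rewrite mulf_neq0 ?invr_eq0 // => /(_ isT).
rewrite -!(addrAC M 1) cosumS => <-.
by field.
Qed.

Let gt_neq i l : (i < l)%N -> (i == l) = false.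
Proof. by move=> il; apply/eqP => e; rewrite e ltnn in il. Qed.

Let gt_neq' i l : (i < l)%N -> (l == i) = false.
Proof. by move=> il; rewrite eq_sym gt_neq. Qed.

Lemma kprod_lower_x m t n x M : (m <= t <= p)%N ->
  \sum_(l < p | (m <= l < t)%N) x 0 l * kprod m t n (x - delta_mx 0 l) (M - 1)
  = (M - (segsum n m t)%:R) * kprod m t n x M
    - (M - segsum x m t) * kprod m t n x (M - 1).
Proof.
case/andP => mt tp; move: m mt n x M; apply: (segment_ind tp) => [|i it IH] n x M.
  by rewrite big_pred0 => [|l]; [rewrite !kprod_nil !segsum_nil !subr0 subrr|lia].
rewrite big_segmentS //= !kprodS // !segsumS // !mxE !eqxx /= natrD.
under eq_bigr => l /andP[il lt].
  rewrite kprodS // !mxE gt_neq // mulr0n subr0 mulrCA; over.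
rewrite -mulr_sumr [M - 1 - x 0 i]addrAC IH.
rewrite (@eq_kprod _ _ n n (x - delta_mx 0 i) x) //; last first.
  by move=> l /andP[il _]; rewrite !mxE gt_neq' // mulr0n subr0.
rewrite (_ : M - 1 - (x 0 i - 1) = M - x 0 i); last by ring.
set s := (segsum n i.+1 t)%:R.
have := @krawtchouk1_lower_x R (n 0 i) (x 0 i) (pp 0 i / cosum i) (M - s).
rewrite (_ : M - 1 - s = M - s - 1) => [e|]; last by ring.
rewrite (_ : M - ((n 0 i)%:R + s) = M - s - (n 0 i)%:R); last by ring.
rewrite [(_ - (n 0 i)%:R) * (_ * _)]mulrA -e.
ring.
Qed.

(** With b_t the substitution of the parameters for the family p_1, ..., p_t,
    this is b_t(p_k) for the index k which the reversal of t indices exchanges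
    with i. *)
Definition dual_weight t i : R := pp 0 i * cosum t / (cosum i.+1 * cosum i).

Lemma kprod_raise_n m t n x M : (m <= t <= p)%N ->
  \sum_(l < p | (m <= l < t)%N) dual_weight t l * kprod m t (inc n l) x M
  = cosum t / cosum m * (M - (segsum n m t)%:R) * kprod m t n x M
    + (segsum x m t - M) * kprod m t n x (M - 1).
Proof.
case/andP => mt tp; move: m mt n x M; apply: (segment_ind tp) => [|i it IH] n x M.
  rewrite big_pred0 => [|l]; last by lia.
  rewrite !kprod_nil !segsum_nil divff ?cosum_neq0 //; ring.
rewrite big_segmentS //= !kprodS // !segsumS // natrD.
under eq_bigr => l /andP[il lt].
  rewrite kprodS // segsum_inc ?il // mxE gt_neq // addn0 mulrCA; over.
rewrite -mulr_sumr IH mxE eqxx addn1.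
have ei l : (i < l < t)%N -> inc n i 0 l = n 0 l.
  by case/andP => il _; rewrite mxE gt_neq' // addn0.
rewrite (eq_segsum ei) (@eq_kprod _ _ (inc n i) n x x) //.
rewrite -natr1; set s := (segsum n i.+1 t)%:R.
have := @krawtchouk1_raise_n R (n 0 i) (x 0 i) (pp 0 i / cosum i) (M - s).
rewrite mulf_neq0 ?invr_eq0 // => /(_ isT).
rewrite (_ : M - (s + 1) = M - s - 1); last by ring.
rewrite (_ : M - 1 - s = M - s - 1); last by ring.
rewrite -!(addrAC M (- 1)) /dual_weight.
have := cosum_ordS i; rewrite cosumS => c1.
set K := krawtchouk1 (n 0 i).+1 _ _ _ => e.
have -> : K = cosum i / pp 0 i * (pp 0 i / cosum i * K).
  by field; rewrite hpp cosum_ord.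
rewrite e; field.
by rewrite hpp cosum_ord c1.
Qed.

Lemma kprod_lower_n m t n x M : (m <= t <= p)%N ->
  \sum_(l < p | (m <= l < t)%N) (n 0 l)%:R * kprod m t (dec n l) x (M - 1)
  = kprod m t n x (M - 1) - kprod m t n x M.
Proof.
case/andP => mt tp; move: m mt n x M; apply: (segment_ind tp) => [|i it IH] n x M.
  by rewrite big_pred0 => [|l]; [rewrite !kprod_nil subrr|lia].
rewrite big_segmentS //= !kprodS //.
under eq_bigr => l /andP[il lt].
  rewrite (_ : (n 0 l)%:R * _ = krawtchouk1 (n 0 i) (x 0 i) (pp 0 i / cosum i)
       (M - (segsum n i.+1 t)%:R) *
     ((n 0 l)%:R * kprod i.+1 t (dec n l) x (M - 1 - x 0 i))); last first.
    case: (posnP (n 0 l)) => [->|n0]; first by rewrite !mul0r mulr0.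
    rewrite kprodS // mxE gt_neq // subn0 mulrCA.
    congr (krawtchouk1 _ _ _ _ * _).
    by rewrite (@segsum_dec _ n l) ?il // -natr1; ring.
  over.
rewrite -mulr_sumr [M - 1 - x 0 i]addrAC IH mxE eqxx subn1.
have ei l : (i < l < t)%N -> dec n i 0 l = n 0 l.
  by case/andP => il _; rewrite mxE gt_neq' // subn0.
rewrite (eq_segsum ei) (@eq_kprod _ _ (dec n i) n x x) //.
set s := (segsum n i.+1 t)%:R.
have := @krawtchouk1_lower_n R (n 0 i) (x 0 i) (pp 0 i / cosum i) (M - s).
rewrite (_ : M - 1 - s = M - s - 1) => [e|]; last by ring.
by rewrite [(n 0 i)%:R * _]mulrA -e; ring.
Qed.

(** The left-hand side is (1 - P_1^m) times the operator L applied to the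
    product.  The double sum is [kprod_p_avg] applied at each x - e_j and summed
    by [kprod_lower_x]; the values at M - 1 cancel. *)
Lemma kprod_spectral_x m t n x M : (m <= t <= p)%N ->
  let S (F : 'I_p -> R) := \sum_(l < p | (m <= l < t)%N) F l in
  (segsum x m t - M) * S (fun i => pp 0 i * kprod m t n (x + delta_mx 0 i) M)
  - cosum t * S (fun j => x 0 j * kprod m t n (x - delta_mx 0 j) M)
  - S (fun j => x 0 j * S (fun i =>
      pp 0 i * kprod m t n (x - delta_mx 0 j + delta_mx 0 i) M))
  + ((cosum m - cosum t) * (M - segsum x m t) + cosum m * segsum x m t)
    * kprod m t n x M
  = cosum m * (segsum n m t)%:R * kprod m t n x M.
Proof.
move=> mtp S.
have avg y L : S (fun i => pp 0 i * kprod m t n (y + delta_mx 0 i) L)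
    = cosum m * kprod m t n y (L - 1) - cosum t * kprod m t n y L.
  by have := kprod_p_avg n y (L - 1) mtp; rewrite subrK => <-; rewrite addrK.
under [S (fun j => _ * S _)]eq_bigr => j _.
  rewrite avg mulrBr !(mulrCA (x 0 j)); over.
rewrite avg sumrB -!mulr_sumr (kprod_lower_x n x M mtp) /S.
ring.
Qed.

(** The left-hand side is the dual operator after the Pochhammer factors of the
    normalization have been cancelled: this removes every denominator in M.
    The double sum is [kprod_raise_n] applied at each n - e_j and summed by
    [kprod_lower_n]. *)
Lemma kprod_spectral_n m t n x M : (m <= t <= p)%N ->
  let S (F : 'I_p -> R) := \sum_(l < p | (m <= l < t)%N) F l in
  S (fun i => dual_weight t i * kprod m t (inc n i) x M)
  + cosum t / cosum m * (M + 1 - (segsum n m t)%:R)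
    * S (fun j => (n 0 j)%:R * kprod m t (dec n j) x M)
  - S (fun j => (n 0 j)%:R * S (fun i =>
      dual_weight t i * kprod m t (inc (dec n j) i) x M))
  + ((1 - cosum t / cosum m) * (M - (segsum n m t)%:R) + (segsum n m t)%:R)
    * kprod m t n x M
  = segsum x m t * kprod m t n x M.
Proof.
move=> mtp S.
have raise k : S (fun i => dual_weight t i * kprod m t (inc k i) x M)
    = cosum t / cosum m * (M - (segsum k m t)%:R) * kprod m t k x M
      + (segsum x m t - M) * kprod m t k x (M - 1) by exact: kprod_raise_n.
under [S (fun j => _ * S _)]eq_bigr => j jmt.
  rewrite raise (_ : _ * _ = cosum t / cosum m
    * (M + 1 - (segsum n m t)%:R) * ((n 0 j)%:R * kprod m t (dec n j) x M)
    + (segsum x m t - M) * ((n 0 j)%:R * kprod m t (dec n j) x (M - 1))); last first.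
    case: (posnP (n 0 j)) => [->|n0]; first by rewrite !mul0r !mulr0 addr0.
    by rewrite (segsum_dec jmt n0) -natr1; ring.
  over.
rewrite big_split /= -!mulr_sumr kprod_lower_n // raise /S.
ring.
Qed.

End Products.

(** * The action of the operators L *)

Section Actions.
Variables (R : realType) (p : nat).
Implicit Types (A B : diffop R p) (f : 'rV[R]_p -> R) (y : 'rV[R]_p).

Lemma act_x0 pp N f y : act_x (0 : diffop R p) pp N f y = 0.
Proof. by rewrite /act_x msupp0 big_seq_fset0. Qed.

Lemma act_xB A B pp N f y :
  act_x (A - B) pp N f y = act_x A pp N f y - act_x B pp N f y.
Proof. by apply/eqP; rewrite eq_sym subr_eq -act_xD subrK. Qed.

Lemma act_x_sum (I : Type) (r : seq I) (P : pred I) (F : I -> diffop R p) pp N f y :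
  act_x (\sum_(i <- r | P i) F i) pp N f y
  = \sum_(i <- r | P i) act_x (F i) pp N f y.
Proof. by elim/big_ind2: _ => [|A a B b <- <-|]; rewrite ?act_x0 ?act_xD. Qed.

Lemma act_xZ A pp N f c y : act_x A pp N (fun z => c * f z) y = c * act_x A pp N f y.
Proof. by rewrite /act_x mulr_sumr; apply: eq_bigr => nu _; rewrite mulrCA. Qed.

Lemma act_x_subZ A pp N f g c y :
  act_x A pp N (fun z => f z - c * g z) y = act_x A pp N f y - c * act_x A pp N g y.
Proof.
rewrite -act_xZ /act_x -sumrB; apply: eq_bigr => nu _; exact: mulrBr.
Qed.

Lemma int_vec0 : int_vec R (0 : 'rV[int]_p) = 0.
Proof. exact: map_mx0. Qed.

Lemma int_vec_delta i : int_vec R (delta_mx 0 i : 'rV[int]_p) = delta_mx 0 i.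
Proof. exact: map_delta_mx. Qed.

Lemma int_vecN (nu : 'rV[int]_p) : int_vec R (- nu) = - int_vec R nu.
Proof. exact: map_mxN. Qed.

Lemma act_op_coef c pp N f y :
  act_x (op_coef c : diffop R p) pp N f y = c y pp N * f y.
Proof. by rewrite act_xU int_vec0 addr0. Qed.

Lemma act_op_fdiff i pp N f y :
  act_x (op_fdiff R i) pp N f y = f (y + delta_mx 0 i) - f y.
Proof.
rewrite act_xB; congr (_ - _); last by rewrite act_op_coef mul1r.
by rewrite act_xU int_vec_delta mul1r.
Qed.

Lemma act_op_bdiff i pp N f y :
  act_x (op_bdiff R i) pp N f y = f y - f (y - delta_mx 0 i).
Proof.
rewrite act_xB; congr (_ - _); first by rewrite act_op_coef mul1r.
by rewrite act_xU int_vecN int_vec_delta mul1r.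
Qed.

Lemma act_coef_fdiff c i pp N f y :
  act_x (op_mul (op_coef c) (op_fdiff R i)) pp N f y
  = c y pp N * (f (y + delta_mx 0 i) - f y).
Proof. by rewrite act_x_mul act_op_coef; congr (_ * _); exact: act_op_fdiff. Qed.

Lemma act_coef_bdiff c i pp N f y :
  act_x (op_mul (op_coef c) (op_bdiff R i)) pp N f y
  = c y pp N * (f y - f (y - delta_mx 0 i)).
Proof. by rewrite act_x_mul act_op_coef; congr (_ * _); exact: act_op_bdiff. Qed.

Lemma act_coef_fdiff_bdiff c i j pp N f y :
  act_x (op_mul (op_coef c) (op_mul (op_fdiff R i) (op_bdiff R j))) pp N f y
  = c y pp N * (f (y + delta_mx 0 i) - f (y - delta_mx 0 j + delta_mx 0 i)
                - f y + f (y - delta_mx 0 j)).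
Proof.
rewrite act_x_mul act_op_coef; congr (_ * _); rewrite act_x_mul.
transitivity ((f (y + delta_mx 0 i) - f (y + delta_mx 0 i - delta_mx 0 j))
              - (f y - f (y - delta_mx 0 j))).
  by apply: etrans; [exact: act_op_fdiff|congr (_ - _); exact: act_op_bdiff].
by rewrite (addrAC y (delta_mx 0 i)); ring.
Qed.

Lemma sum2_cross (I : finType) (S : {pred I}) (a b u d : I -> R) (v : I -> I -> R)
    (c : R) :
  \sum_(i in S) \sum_(j in S) a i * b j * (u i - v i j - c + d j) =
  (\sum_(j in S) b j) * (\sum_(i in S) a i * u i)
  - \sum_(j in S) b j * (\sum_(i in S) a i * v i j)
  - (\sum_(i in S) a i) * (\sum_(j in S) b j) * c
  + (\sum_(i in S) a i) * (\sum_(j in S) b j * d j).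
Proof.
have -> : \sum_(j in S) b j * (\sum_(i in S) a i * v i j)
    = \sum_(i in S) \sum_(j in S) a i * b j * v i j.
  rewrite exchange_big /=; apply: eq_bigr => j _; rewrite mulr_sumr.
  by apply: eq_bigr => i _; ring.
rewrite mulr_sumr -mulrA !mulr_suml -!sumrB -big_split /=; apply: eq_bigr => i _.
rewrite mulr_sumr !mulr_suml mulr_sumr -!sumrB -big_split /=.
by apply: eq_bigr => j _; ring.
Qed.

(** The missing diagonal terms i = j of the double sum are shifts by
    e_i - e_i = 0, so that adding them changes only the multiplication operator;
    with them the double sum is a composite of two single sums. *)
Lemma act_Lop (S : {set 'I_p}) (q_ : 'I_p -> coef R p) (M : coef R p) pp N f y :
  let q i := q_ i y pp N in
  let Q := \sum_(i in S) q i in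
  let Y := \sum_(i in S) y 0 i in
  let m := M y pp N in
  act_x (Lop S q_ M) pp N f y =
  (Y - m) * (\sum_(i in S) q i * f (y + delta_mx 0 i))
  - (1 - Q) * (\sum_(j in S) y 0 j * f (y - delta_mx 0 j))
  - \sum_(j in S) y 0 j * (\sum_(i in S) q i * f (y - delta_mx 0 j + delta_mx 0 i))
  + (Q * (m - Y) + Y) * f y.
Proof.
move=> q Q Y m.
pose up i := f (y + delta_mx 0 i); pose dn j := f (y - delta_mx 0 j).
pose ud i j := f (y - delta_mx 0 j + delta_mx 0 i).
pose T i j := q i * y 0 j * (up i - ud i j - f y + dn j).
have -> : act_x (Lop S q_ M) pp N f y =
    (\sum_(i in S) \sum_(j in S) T i j)
    - m * (\sum_(i in S) q i * (up i - f y)) + \sum_(j in S) y 0 j * (f y - dn j).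
  transitivity (\sum_(i in S) \sum_(j in S | j != i) T i j
    + \sum_(i in S) (q i * (y 0 i - m) * (up i - f y)
                     + (1 - q i) * y 0 i * (f y - dn i))).
    rewrite /Lop act_xD !act_x_sum; congr (_ + _); apply: eq_bigr => i _.
      by rewrite act_x_sum; apply: eq_bigr => j _; exact: act_coef_fdiff_bdiff.
    by rewrite act_xD; congr (_ + _); [exact: act_coef_fdiff|exact: act_coef_bdiff].
  rewrite mulr_sumr -sumrB -!big_split /=; apply: eq_bigr => i iS.
  by rewrite [\sum_(j in S) T i j](bigD1 i) //= {2}/T /ud subrK -/(up i); ring.
rewrite sum2_cross -/Q -/Y.
under [\sum_(i in S) q i * (up i - _)]eq_bigr => i _ do rewrite mulrBr.
under [\sum_(j in S) y 0 j * (_ - dn j)]eq_bigr => j _ do rewrite mulrBr.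
rewrite !sumrB -!mulr_suml -/Q -/Y.
ring.
Qed.

End Actions.

(** * The spectral equations in x *)

Section SpectralX.
Variables (R : realType) (p : nat) (pp : 'rV[R]_p).
Hypothesis hpp : forall j, pp 0 j != 0.
Hypothesis hpsum : forall j : 'I_p, psum pp j.+1 != 1.

Lemma psum_segsum (V : nmodType) (v : 'rV[V]_p) m : psum v m = segsum v 0 m.
Proof. by []. Qed.

Lemma vsum_segsum (V : nmodType) (v : 'rV[V]_p) : vsum v = segsum v 0 p.
Proof. by apply: eq_bigl => i; rewrite /= ltn_ord. Qed.

Lemma krawtchouk_kprod n x N :
  krawtchouk n x pp N = (poch (- N) (vsum n))^-1 * kprod pp 0 p n x N.
Proof.
rewrite /krawtchouk /kprod; congr (_ * _).
rewrite [RHS](eq_bigl xpredT) => [|j]; last by rewrite /= ltn_ord.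
apply: eq_bigr => j _; congr (krawtchouk1 _ _ _ (_ - _)).
rewrite vsum_segsum psum_segsum (@segsum_split _ _ n 0 j.+1 p) ?ltn_ord // natrD; ring.
Qed.

Lemma segsum_cosum m t : (m <= t)%N -> segsum pp m t = cosum pp m - cosum pp t.
Proof.
move=> mt; rewrite /cosum !psum_segsum (@segsum_split _ _ _ 0 m t) ?mt //; ring.
Qed.

(** The operator leaves x_1, ..., x_(j-1) alone, hence it acts on the factor of
    index at least j and commutes with the others. *)
Lemma Lx_spectral (j : 'I_p) n x N :
  act_x (Lx R j) pp N (fun y => krawtchouk n y pp N) x
  = (\sum_(i < p | (j <= i)%N) n ord0 i)%:R * krawtchouk n x pp N.
Proof.
have jp : (j <= p)%N := ltnW (ltn_ord j).
have c0 : cosum pp j != 0 by apply: cosum_neq0.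
have toS (F : 'I_p -> R) :
    \sum_(i in [set i : 'I_p | (j <= i)%N]) F i = \sum_(i < p | (j <= i < p)%N) F i.
  by apply: eq_bigl => i; rewrite inE ltn_ord andbT.
pose M := N - segsum x 0 j.
pose C := (poch (- N) (vsum n))^-1 * kprod pp 0 j n x (N - (segsum n j p)%:R).
have fE (y : 'rV[R]_p) : (forall i : 'I_p, (i < j)%N -> y 0 i = x 0 i) ->
    krawtchouk n y pp N = C * kprod pp j p n y M.
  move=> yx; rewrite krawtchouk_kprod (@kprod_split _ _ _ 0 j) ?jp //.
  rewrite mulrA /C /M (@eq_segsum _ _ y x) => [|i /andP[_]]; last exact: yx.
  by rewrite (@eq_kprod _ _ _ 0 j n n y x) // => i /andP[_]; exact: yx.
have upE (u : 'rV[R]_p) (i k : 'I_p) : (j <= i)%N -> (k < j)%N ->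
    (u + delta_mx 0 i) 0 k = u 0 k.
  by move=> ji kj; rewrite !mxE (_ : (k == i) = false) ?addr0 // -val_eqE /=; lia.
have dnE (u : 'rV[R]_p) (i k : 'I_p) : (j <= i)%N -> (k < j)%N ->
    (u - delta_mx 0 i) 0 k = u 0 k.
  by move=> ji kj; rewrite !mxE (_ : (k == i) = false) ?subr0 // -val_eqE /=; lia.
rewrite /Lx act_Lop /= !toS -/(cosum pp j) -/M.
rewrite ?(_ : N - psum x j = M) //.
rewrite -mulr_suml -/(segsum pp j p) segsum_cosum // -/(segsum x j p).
have e1 : \sum_(i < p | (j <= i < p)%N)
      pp 0 i / cosum pp j * krawtchouk n (x + delta_mx 0 i) pp N
    = C / cosum pp j * \sum_(i < p | (j <= i < p)%N)
      pp 0 i * kprod pp j p n (x + delta_mx 0 i) M.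
  rewrite mulr_sumr; apply: eq_bigr => i /andP[ji _].
  by rewrite fE => [|k kj]; [ring|exact: upE].
have e2 : \sum_(i < p | (j <= i < p)%N)
      x 0 i * krawtchouk n (x - delta_mx 0 i) pp N
    = C * \sum_(i < p | (j <= i < p)%N)
      x 0 i * kprod pp j p n (x - delta_mx 0 i) M.
  rewrite mulr_sumr; apply: eq_bigr => i /andP[ji _].
  by rewrite fE => [|k kj]; [ring|exact: dnE].
have e3 : \sum_(l < p | (j <= l < p)%N) x 0 l *
      (\sum_(i in [set i : 'I_p | (j <= i)%N])
        pp 0 i / cosum pp j * krawtchouk n (x - delta_mx 0 l + delta_mx 0 i) pp N)
    = C / cosum pp j * \sum_(l < p | (j <= l < p)%N) x 0 l *
      (\sum_(i < p | (j <= i < p)%N)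
        pp 0 i * kprod pp j p n (x - delta_mx 0 l + delta_mx 0 i) M).
  rewrite mulr_sumr; apply: eq_bigr => l /andP[jl _].
  rewrite mulrCA toS; congr (_ * _); rewrite mulr_sumr.
  apply: eq_bigr => i /andP[ji _].
  rewrite fE => [|k kj]; first by ring.
  by rewrite upE // dnE.
rewrite e1 e2 e3 fE //.
have -> : \sum_(i < p | (j <= i)%N) n ord0 i = segsum n j p.
  by apply: eq_bigl => i; rewrite ltn_ord andbT.
have := kprod_spectral_x hpp hpsum n x M (m := j) (t := p).
rewrite jp leqnn => /(_ isT) /= e.
rewrite -[RHS](mulKf c0).
have -> : cosum pp j * ((segsum n j p)%:R * (C * kprod pp j p n x M))
  = C * (cosum pp j * (segsum n j p)%:R * kprod pp j p n x M) by ring.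
by rewrite -e; field.
Qed.

End SpectralX.

(** * The spectral equations in n for non-integer N *)

Section SpectralN.
Variables (R : realType) (p : nat).
Implicit Types (f : 'rV[R]_p -> R) (y x : 'rV[R]_p) (n : 'rV[nat]_p).

Lemma act_bmap (A : diffop R p) pp N f y :
  act_x (bmap A) pp N f y
  = act_x A (param_dual pp) N (fun z => f (rvrev z)) (rvrev y).
Proof.
rewrite /bmap act_x_sum; apply: eq_bigr => nu _.
by rewrite act_xU rvrev_int_vec rvrevD rvrevK.
Qed.

Variable pp : 'rV[R]_p.
Hypothesis hpp : forall j, pp 0 j != 0.
Hypothesis hpsum : forall j : 'I_p, psum pp j.+1 != 1.

(** The sum telescopes: with c_i = 1 - P_1^i, the weight of index l is
    c_t (1 / c_(l+1) - 1 / c_l) when indices start at 0. *)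
Lemma sum_dual_weight m t : (m <= t <= p)%N ->
  \sum_(l < p | (m <= l < t)%N) dual_weight pp t l = 1 - cosum pp t / cosum pp m.
Proof.
case/andP => mt tp; move: m mt; apply: (segment_ind tp) => [|i it IH].
  by rewrite big_pred0 => [|l]; [rewrite divff ?subrr ?cosum_neq0|lia].
have ci : cosum pp i != 0 by apply/cosum_neq0/ltnW.
have := cosum_neq0 hpsum (ltn_ord i).
by rewrite big_segmentS //= IH /dual_weight cosumS => cS; field; rewrite ci cS.
Qed.

Lemma param_dualE k : param_dual pp 0 k = dual_weight pp p (rev_ord k).
Proof. by rewrite mxE vsum_segsum. Qed.

Lemma psum_param_dual j : (j <= p)%N ->
  psum (param_dual pp) j = 1 - cosum pp p / cosum pp (p - j).
Proof.
move=> jp; rewrite -(@sum_dual_weight (p - j) p) ?leq_subr ?leqnn //.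
rewrite /psum (reindex_inj rev_ord_inj) /=.
apply: eq_big => [l|l _]; last by rewrite param_dualE rev_ordK.
by have := ltn_ord l; lia.
Qed.

(** After the reversal of indices, L_j^n involves n_1, ..., n_t, and dividing the
    dual parameters by one minus a partial sum replaces the weights for
    p_1, ..., p_p by those for p_1, ..., p_t. *)
Lemma act_Ln (j : 'I_p) N f y :
  let t := (p - j)%N in
  let S (F : 'I_p -> R) := \sum_(l < p | (0 <= l < t)%N) F l in
  let w := dual_weight pp t in
  let L := N - segsum y 0 p in
  act_x (Ln R j) pp N f y =
  - L * S (fun i => w i * f (y + delta_mx 0 i))
  - cosum pp t * S (fun l => y 0 l * f (y - delta_mx 0 l))
  - S (fun l => y 0 l * S (fun i => w i * f (y - delta_mx 0 l + delta_mx 0 i)))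
  + ((1 - cosum pp t) * L + segsum y 0 t) * f y.
Proof.
move=> t S w L; have tp : (t <= p)%N by exact: leq_subr.
have toS (F : 'I_p -> R) :
    \sum_(i in [set i : 'I_p | (j <= i)%N]) F i = S (fun l => F (rev_ord l)).
  rewrite (reindex_inj rev_ord_inj) /=; apply: eq_bigl => l.
  by rewrite inE /= /t; have := ltn_ord l; have := ltn_ord j; lia.
have up (z : 'rV[R]_p) l : rvrev (rvrev z + delta_mx 0 (rev_ord l)) = z + delta_mx 0 l.
  rewrite rvrevD rvrevK; congr (_ + _); apply/rowP => i.
  by rewrite !mxE (inj_eq rev_ord_inj).
have dn (z : 'rV[R]_p) l : rvrev z - delta_mx 0 (rev_ord l) = rvrev (z - delta_mx 0 l).
  by apply/rowP => i; rewrite !mxE (can2_eq rev_ordK rev_ordK).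
have ct : cosum pp t != 0 by apply: cosum_neq0.
have c0 : cosum pp p != 0 by apply: cosum_neq0.
have wE l : param_dual pp 0 (rev_ord l) / (1 - psum (param_dual pp) j) = w l.
  rewrite param_dualE rev_ordK psum_param_dual ?(ltnW (ltn_ord j)) // /w /dual_weight.
  have ci : cosum pp l != 0 by apply/cosum_neq0/ltnW.
  have ci1 : cosum pp l.+1 != 0 by apply: cosum_neq0.
  by rewrite -/t subKr; field; rewrite ?ct ?c0 ?ci ?ci1.
rewrite /Ln act_bmap /Lx act_Lop /= !toS.
have -> : psum (rvrev y) j = segsum y t p.
  rewrite /psum (reindex_inj rev_ord_inj) /=; apply: eq_big => [l|l _].
    by rewrite /t; have := ltn_ord l; have := ltn_ord j; lia.
  by rewrite mxE rev_ordK.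
have -> : S (fun l => rvrev y 0 (rev_ord l)) = segsum y 0 t.
  by apply: eq_bigr => l _; rewrite mxE rev_ordK.
have -> : S (fun l => param_dual pp 0 (rev_ord l) / (1 - psum (param_dual pp) j))
    = 1 - cosum pp t.
  by rewrite /S (eq_bigr w) // sum_dual_weight // cosum0 divr1.
have LE : N - segsum y t p - segsum y 0 t = L.
  by rewrite /L (@segsum_split _ _ y 0 t p) //; ring.
have LE' : segsum y 0 t - (N - segsum y t p) = - L by rewrite -LE; ring.
rewrite LE LE' rvrevK subKr; congr (- L * _ - cosum pp t * _ - _ + _).
- by apply: eq_bigr => l _; rewrite wE up.
- by apply: eq_bigr => l _; rewrite mxE rev_ordK dn rvrevK.
- apply: eq_bigr => l _; rewrite mxE rev_ordK toS; congr (_ * _).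
  by apply: eq_bigr => i _; rewrite wE dn up.
Qed.

(** Operators act on functions of a real vector.  Truncation extends a function
    of the index to all real vectors; at points outside the nonnegative integer
    ones its values meet vanishing coefficients. *)
Definition trunc_index y : 'rV[nat]_p := map_mx Num.truncn y.

Lemma trunc_indexK n : trunc_index (real_index R n) = n.
Proof. by apply/rowP => i; rewrite !mxE natrK. Qed.

Lemma real_index_inc n i : real_index R n + delta_mx 0 i = real_index R (inc n i).
Proof. by apply/rowP => l; rewrite !mxE natrD. Qed.

Lemma real_index_dec n i : (0 < n 0%R i)%N ->
  real_index R n - delta_mx 0 i = real_index R (dec n i).
Proof. by move=> n0; rewrite -{1}(inc_dec n0) -real_index_inc addrK. Qed.

Lemma segsum_real_index n m t : segsum (real_index R n) m t = (segsum n m t)%:R.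
Proof.
rewrite /segsum natr_sum; apply: eq_bigr => i _; exact: mxE.
Qed.

Lemma poch_neq0 (N : R) k : (forall i : 'I_k, N != i%:R) -> poch (- N) k != 0.
Proof.
move=> Nk; apply/prodf_neq0 => i _.
by rewrite addrC subr_eq0 eq_sym.
Qed.

(** Passing from n to n + e_l multiplies (-N)_|n| by |n| - N, which is the
    coefficient of that shift, and passing to n - e_l divides it by
    |n| - 1 - N.  What remains is [kprod_spectral_n] for the first p - j
    variables. *)
Lemma Ln_spectral_generic (j : 'I_p) n x N : (forall k : nat, N != k%:R) ->
  act_x (Ln R j) pp N (fun y => krawtchouk (trunc_index y) x pp N) (real_index R n)
  = (\sum_(i < p | (i < p - j)%N) x 0 i) * krawtchouk n x pp N.
Proof.
move=> Nk; rewrite act_Ln /=; set t := (p - j)%N.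
have tp : (t <= p)%N by exact: leq_subr.
(* The part of K_p that does not change with the first t components of n. *)
pose H := kprod pp t p n x (N - segsum x 0 t) / poch (- N) (segsum n 0 p).
pose M := N - (segsum n t p)%:R.
have kE n' : (forall i : 'I_p, (t <= i < p)%N -> n' 0 i = n 0 i) ->
    krawtchouk n' x pp N = poch (- N) (segsum n 0 p) / poch (- N) (segsum n' 0 p)
      * H * kprod pp 0 t n' x M.
  move=> e; rewrite krawtchouk_kprod (@kprod_split _ _ _ 0 t) ?tp // vsum_segsum.
  rewrite (eq_segsum e) (@eq_kprod _ _ _ t p n' n x x) // /H /M.
  have p0 : poch (- N) (segsum n 0 p) != 0 by apply: poch_neq0.
  have p1 : poch (- N) (segsum n' 0 p) != 0 by apply: poch_neq0.
  by field; rewrite p0 p1.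
have dN : (segsum n 0 p)%:R - N != 0 by rewrite subr_eq0 eq_sym.
set d := segsum n 0 p in H kE dN *.
have n0t i (v : 'rV[nat]_p) : (i < t)%N -> (0 <= i < p)%N by move=> it; lia.
have incE v (i l : 'I_p) : (i < t)%N -> (t <= l < p)%N -> inc v i 0 l = v 0 l.
  move=> it /andP[tl _]; rewrite mxE (_ : (l == i) = false) ?addn0 //.
  by rewrite -val_eqE /=; lia.
have decE v (i l : 'I_p) : (i < t)%N -> (t <= l < p)%N -> dec v i 0 l = v 0 l.
  move=> it /andP[tl _]; rewrite mxE (_ : (l == i) = false) ?subn0 //.
  by rewrite -val_eqE /=; lia.
have pd : poch (- N) d != 0 by apply: poch_neq0.
have e0 : krawtchouk (trunc_index (real_index R n)) x pp N = H * kprod pp 0 t n x M.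
  by rewrite trunc_indexK kE // divff // mul1r.
have e1 : \sum_(l < p | (l < t)%N) dual_weight pp t l
      * krawtchouk (trunc_index (real_index R n + delta_mx 0 l)) x pp N
    = H / (d%:R - N) * \sum_(l < p | (l < t)%N)
        dual_weight pp t l * kprod pp 0 t (inc n l) x M.
  rewrite mulr_sumr; apply: eq_bigr => l lt.
  rewrite real_index_inc trunc_indexK kE => [|i]; last exact: incE.
  rewrite segsum_inc ?ltn_ord // -/d pochSr addrC; field.
  by rewrite dN pd.
have e2 : \sum_(l < p | (l < t)%N) real_index R n 0 l
      * krawtchouk (trunc_index (real_index R n - delta_mx 0 l)) x pp N
    = H * (d%:R - 1 - N) * \sum_(l < p | (l < t)%N)
        (n 0 l)%:R * kprod pp 0 t (dec n l) x M.
  rewrite mulr_sumr; apply: eq_bigr => l lt; rewrite [real_index R n 0 l]mxE.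
  case: (posnP (n 0 l)) => [->|nl]; first by rewrite !mul0r mulr0.
  rewrite real_index_dec // trunc_indexK kE => [|i]; last exact: decE.
  have de : d = (segsum (dec n l) 0 p).+1 by apply: segsum_dec; rewrite ?ltn_ord.
  rewrite {1}de pochSr de -natr1.
  have p1 : poch (- N) (segsum (dec n l) 0 p) != 0 by apply: poch_neq0.
  by field.
have e3 : \sum_(l < p | (l < t)%N) real_index R n 0 l
      * (\sum_(i < p | (i < t)%N) dual_weight pp t i * krawtchouk
          (trunc_index (real_index R n - delta_mx 0 l + delta_mx 0 i)) x pp N)
    = H * \sum_(l < p | (l < t)%N) (n 0 l)%:R * (\sum_(i < p | (i < t)%N)
        dual_weight pp t i * kprod pp 0 t (inc (dec n l) i) x M).
  rewrite mulr_sumr; apply: eq_bigr => l lt; rewrite [real_index R n 0 l]mxE.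
  case: (posnP (n 0 l)) => [->|nl]; first by rewrite !mul0r mulr0.
  rewrite mulrCA; congr (_ * _); rewrite mulr_sumr; apply: eq_bigr => i it.
  rewrite real_index_dec // real_index_inc trunc_indexK kE => [|k kt]; last first.
    by rewrite incE // decE.
  rewrite segsum_inc ?ltn_ord // -(@segsum_dec _ n l) ?ltn_ord // -/d divff //.
  by ring.
rewrite e0 e1 e2 e3 !segsum_real_index -/d kE // divff // mul1r.
have := kprod_spectral_n hpp hpsum n x M (m := 0) (t := t).
rewrite tp => /(_ isT) /=; rewrite cosum0 divr1 => e.
have ed : d%:R = (segsum n 0 t)%:R + (segsum n t p)%:R :> R.
  by rewrite /d (@segsum_split _ _ n 0 t p) ?tp // natrD.
rewrite [RHS]mulrCA -[\sum_(i < p | (i < t)%N) x 0 i]/(segsum x 0 t) -e /M.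
move: dN; rewrite ed => dN; field.
by [].
Qed.

End SpectralN.

(** * Polynomial dependence on the size parameter *)

Section PolynomialFunctions.
Variable R : realType.
Implicit Types (g h : R -> R).

(** Polynomial dependence on the size parameter gives both continuity and the
    divisibility by N' - N that removes the pole of K_p at |n| > N. *)
Definition polyfun g := exists P : {poly R}, forall r, g r = P.[r].

Lemma polyfun_cst a : polyfun (fun=> a).
Proof. by exists a%:P => r; rewrite hornerC. Qed.

Lemma polyfun_id : polyfun (fun r => r).
Proof. by exists 'X => r; rewrite hornerX. Qed.

Lemma polyfunD g h : polyfun g -> polyfun h -> polyfun (fun r => g r + h r).
Proof. by move=> [P gP] [Q hQ]; exists (P + Q) => r; rewrite hornerD gP hQ. Qed.

Lemma polyfunM g h : polyfun g -> polyfun h -> polyfun (fun r => g r * h r).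
Proof. by move=> [P gP] [Q hQ]; exists (P * Q) => r; rewrite hornerM gP hQ. Qed.

Lemma polyfunN g : polyfun g -> polyfun (fun r => - g r).
Proof. by move=> [P gP]; exists (- P) => r; rewrite hornerN gP. Qed.

Lemma polyfun_sum (I : Type) (s : seq I) (C : pred I) (F : I -> R -> R) :
  (forall i, polyfun (F i)) -> polyfun (fun r => \sum_(i <- s | C i) F i r).
Proof.
move=> FP; have /choice [P PE] := FP; exists (\sum_(i <- s | C i) P i) => r.
by rewrite horner_sum; apply: eq_bigr.
Qed.

Lemma polyfun_prod (I : Type) (s : seq I) (C : pred I) (F : I -> R -> R) :
  (forall i, polyfun (F i)) -> polyfun (fun r => \prod_(i <- s | C i) F i r).
Proof.
move=> FP; have /choice [P PE] := FP; exists (\prod_(i <- s | C i) P i) => r.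
by rewrite horner_prod; apply: eq_bigr.
Qed.

Lemma polyfun_poch g k : polyfun g -> polyfun (fun r => poch (g r) k).
Proof. by move=> gP; apply: polyfun_prod => i; apply/polyfunD/polyfun_cst. Qed.

Lemma polyfun_krawtchouk1 n x q g :
  polyfun g -> polyfun (fun r => krawtchouk1 n x q (g r)).
Proof.
move=> gP; apply: polyfun_sum => k; apply/polyfunM; first exact: polyfun_cst.
by apply/polyfun_poch/polyfunD/polyfun_cst/polyfunN.
Qed.

Lemma polyfun_kprod p (pp : 'rV[R]_p) m t n x : polyfun (kprod pp m t n x).
Proof.
apply: polyfun_prod => i; apply/polyfun_krawtchouk1/polyfunD; last exact: polyfun_cst.
by apply/polyfunD/polyfun_cst/polyfun_id.
Qed.

Lemma polyfun_cvg g N : polyfun g -> (g r @[r --> N^'] --> g N)%classic.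
Proof.
move=> [P gP]; rewrite gP (_ : g = horner P); last by apply/funext.
by apply: cvg_within_filter; exact: continuous_horner.
Qed.

Lemma polyfun_div_cvg g h N : polyfun g -> polyfun h -> h N != 0 ->
  ((h r)^-1 * g r @[r --> N^'] --> (h N)^-1 * g N)%classic.
Proof.
move=> gP hP hN; apply: cvgM; last exact: polyfun_cvg.
by apply: cvgV => //; exact: polyfun_cvg.
Qed.

(** At r = d the Pochhammer symbol has a simple zero, because d < k, and it is
    compensated by the zero of g. *)
Lemma polyfun_div_poch_cvg g d k : polyfun g -> (d < k)%N -> g d%:R = 0 ->
  (cvg ((poch (- r) k)^-1 * g r @[r --> (d%:R : R)^']))%classic.
Proof.
move=> [P gP] dk gd.
have /factor_theorem [Q PQ] : root P d%:R by rewrite /root -gP gd.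
pose U r := \prod_(i < k | i != Ordinal dk) (- r + i%:R : R).
have pU r : poch (- r) k = (- r + d%:R) * U r.
  by rewrite /poch (bigD1 (Ordinal dk)).
have UP : polyfun U.
  by apply: polyfun_prod => i; apply/polyfunD/polyfun_cst/polyfunN/polyfun_id.
have Ud : U d%:R != 0.
  apply/prodf_neq0 => i id; rewrite addrC subr_eq0 eqr_nat.
  by apply: contraNneq id => e; apply/eqP/val_inj.
have QP : polyfun (fun r => - Q.[r]) by apply: polyfunN; exists Q.
(* Away from d, cancelling r - d in (r - d) Q(r) and -(r - d) U(r). *)
apply: (cvgP ((U d%:R)^-1 * - Q.[d%:R])).
apply: cvg_trans (polyfun_div_cvg QP UP Ud).
apply: near_eq_cvg; near=> r.
have rd : r - d%:R != 0.
  by rewrite subr_eq0; near: r; exact: nbhs_dnbhs_neq.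
rewrite gP PQ hornerM hornerXsubC pU (_ : - r + d%:R = - (r - d%:R)); last by ring.
have [U0|U0] := eqVneq (U r) 0; first by rewrite U0 mulr0 invr0 !mul0r.
by field; rewrite rd U0.
Unshelve. all: by end_near. Qed.

(** Near N there are finitely many natural numbers, and the neighbourhood is
    punctured. *)
Lemma near_nonnat (N : R) : \forall r \near N^'%classic, forall k : nat, r != k%:R.
Proof.
pose b := Num.Def.archi_bound `|N|.
have Nb : N < b%:R.
  by apply: le_lt_trans (ler_norm N) _; apply: archi_boundP; exact: normr_ge0.
have small : \forall r \near N^'%classic, forall i : 'I_b, r != i%:R.
  apply: filter_forall => i; have [<-|Ni] := eqVneq N i%:R.
    exact: nbhs_dnbhs_neq.
  by apply: nbhs_dnbhs; apply: open_nbhs_nbhs; split; [exact: open_neq|].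
near=> r => k; have [kb|bk] := ltnP k b.
  by have /(_ (Ordinal kb)) : forall i : 'I_b, r != i%:R by near: r.
rewrite lt_eqF // (@lt_le_trans _ _ b%:R) ?ler_nat //.
by near: r; apply: nbhs_dnbhs; exact: lt_nbhsl.
Unshelve. all: by end_near. Qed.

End PolynomialFunctions.

(** * Operators preserving the admissible indices *)

Section Tame.
Variables (R : realType) (p : nat) (pp : 'rV[R]_p).
Implicit Types (A B : diffop R p) (n k : 'rV[nat]_p) (nu : 'rV[int]_p).

Lemma int_vec_inj : injective (@int_vec R p).
Proof.
move=> u v /rowP e; apply/rowP => i; have := e i; rewrite !mxE.
exact: intr_inj.
Qed.

(** An indicator function isolates one coefficient.  Properties of coefficients
    thus reduce to properties of the action, which behave well under
    products. *)
Lemma coef_act A nu y N :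
  A@_nu y pp N = act_x A pp N (fun z => (z == y + int_vec R nu)%:R) y.
Proof.
rewrite /act_x; have [nuA|nuA] := boolP (nu \in msupp A); last first.
  rewrite mcoeff_outdom // big1_seq // => mu /andP[_ muA].
  rewrite (inj_eq (addrI y)) (inj_eq int_vec_inj).
  by case: eqP muA => [->|_]; [rewrite (negbTE nuA)|rewrite mulr0].
rewrite (big_fsetD1 nu) //= eqxx mulr1 big1_seq ?addr0 // => mu /andP[_].
rewrite in_fsetD1 => /andP[/negPf munu _].
by rewrite (inj_eq (addrI y)) (inj_eq int_vec_inj) munu mulr0.
Qed.

(** The coefficients are polynomial in the size parameter; functions vanishing
    at all nonnegative integer points form an invariant subspace; when the size
    is a natural number d, so do those vanishing at the points with |k| <= d.
    The last two say that no coefficient leads out of these sets of points. *)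
Definition tame A :=
  [/\ forall f : R -> 'rV[R]_p -> R, (forall z, polyfun (fun r => f r z)) ->
        forall y, polyfun (fun r => act_x A pp r (f r) y),
      forall r f, (forall k, f (real_index R k) = 0) ->
        forall n, act_x A pp r f (real_index R n) = 0
    & forall d f, (forall k, (vsum k <= d)%N -> f (real_index R k) = 0) ->
        forall n, (vsum n <= d)%N -> act_x A pp d%:R f (real_index R n) = 0].

Lemma tame_const a : tame (op_const p a).
Proof.
by split=> [f fP y|r f f0 n|d f f0 n nd]; rewrite ?act_op_coef ?f0 ?mulr0 //;
  (under [X in polyfun X]funext do rewrite act_op_coef);
  apply: polyfunM; [exact: polyfun_cst|exact: fP].
Qed.

Lemma tameD A B : tame A -> tame B -> tame (A + B).
Proof.
move=> [A1 A2 A3] [B1 B2 B3]; split=> [f fP y|r f f0 n|d f f0 n nd].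
- under [X in polyfun X]funext do rewrite act_xD.
  by apply: polyfunD; [exact: A1|exact: B1].
- by rewrite act_xD A2 // B2 // addr0.
- by rewrite act_xD (A3 d) // (B3 d) // addr0.
Qed.

Lemma tameM A B : tame A -> tame B -> tame (op_mul A B).
Proof.
move=> [A1 A2 A3] [B1 B2 B3]; split=> [f fP y|r f f0 n|d f f0 n nd].
- under [X in polyfun X]funext do rewrite act_x_mul.
  by apply: A1 => z; exact: B1.
- by rewrite act_x_mul A2 // => k; exact: B2.
- by rewrite act_x_mul (A3 d) // => k kd; exact: B3.
Qed.

Hypothesis hpsum : forall j : 'I_p, psum pp j.+1 != 1.

(** A shift lowering n_l has the factor n_l, and a shift raising |n| has the
    factor |n| - N. *)
Lemma tame_Ln (j : 'I_p) : tame (Ln R j).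
Proof.
split=> [f fP y|r f f0 n|d f f0 n nd].
- under [X in polyfun X]funext do rewrite act_Ln //=.
  have fPc (c : R) z : polyfun (fun r => c * f r z).
    by apply: polyfunM (fP z); exact: polyfun_cst.
  have LP : polyfun (fun r => r - segsum y 0 p).
    by apply/polyfunD/polyfun_cst/polyfun_id.
  apply/polyfunD; last first.
    apply/polyfunM/fP/polyfunD/polyfun_cst/polyfunM => //; exact: polyfun_cst.
  apply/polyfunD; last first.
    apply/polyfunN/polyfun_sum => l; apply/polyfunM; first exact: polyfun_cst.
    by apply: polyfun_sum => i.
  apply/polyfunD; last first.
    by apply/polyfunN/polyfunM/polyfun_sum => [|l] //; exact: polyfun_cst.
  by apply/polyfunM/polyfun_sum => [|l] //; exact: polyfunN.
- rewrite act_Ln //= f0 mulr0 addr0.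
  rewrite big1 => [|l _]; last by rewrite real_index_inc f0 mulr0.
  rewrite mulr0 sub0r big1 => [|l _]; last first.
    rewrite mxE; case: (posnP (n 0 l)) => [->|nl]; first by rewrite mul0r.
    by rewrite real_index_dec // f0 mulr0.
  rewrite mulr0 oppr0 sub0r big1 ?oppr0 // => l _.
  rewrite mxE; case: (posnP (n 0 l)) => [->|nl]; first by rewrite mul0r.
  rewrite real_index_dec // big1 ?mulr0 // => i _.
  by rewrite real_index_inc f0 mulr0.
rewrite vsum_segsum in nd.
have decd l : (0 < n 0%R l)%N -> (segsum (dec n l) 0 p < d)%N.
  move=> nl; apply: leq_trans nd; rewrite (@segsum_dec _ n l) ?ltn_ord //.
rewrite act_Ln //= f0 ?vsum_segsum // mulr0 addr0 segsum_real_index.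
have -> : - (d%:R - (segsum n 0 p)%:R) * (\sum_(l < p | (l < p - j)%N)
     dual_weight pp (p - j) l * f (real_index R n + delta_mx 0 l)) = 0.
  have [->|nd'] := eqVneq (segsum n 0 p) d; first by rewrite subrr oppr0 mul0r.
  rewrite big1 ?mulr0 // => l _; rewrite real_index_inc f0 ?mulr0 //.
  by rewrite vsum_segsum segsum_inc ?ltn_ord // ltn_neqAle nd'.
rewrite sub0r big1 => [|l _]; last first.
  rewrite mxE; case: (posnP (n 0 l)) => [->|nl]; first by rewrite mul0r.
  by rewrite real_index_dec // f0 ?mulr0 // vsum_segsum ltnW ?decd.
rewrite mulr0 oppr0 sub0r big1 ?oppr0 // => l _.
rewrite mxE; case: (posnP (n 0 l)) => [->|nl]; first by rewrite mul0r.
rewrite real_index_dec // big1 ?mulr0 // => i _.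
by rewrite real_index_inc f0 ?mulr0 // vsum_segsum segsum_inc ?ltn_ord ?decd.
Qed.

Lemma in_algebra_tame A : in_algebra (@Ln R p) A -> tame A.
Proof.
elim=> {A} [a|j|A B _ A1 _ B1|A B _ A1 _ B1].
- exact: tame_const.
- exact: tame_Ln.
- exact: tameD.
- exact: tameM.
Qed.

End Tame.

(** * The action on the index as a limit *)

Section IndexAction.
Variables (R : realType) (p : nat) (pp : 'rV[R]_p).
Implicit Types (A B : diffop R p) (n k : 'rV[nat]_p) (nu : 'rV[int]_p).

Lemma admissible_poch_neq0 (N : R) n : admissible N n -> poch (- N) (vsum n) != 0.
Proof.
move=> adm; apply: poch_neq0 => i; apply/negP => /eqP Ni.
have := adm; rewrite Ni => /(_ (natr_nat _ _)).
by rewrite ler_nat leqNgt ltn_ord.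
Qed.

Lemma krawtchouk_cvg (N : R) n x : admissible N n ->
  (krawtchouk n x pp r @[r --> N^'] --> krawtchouk n x pp N)%classic.
Proof.
move=> /admissible_poch_neq0 pN; rewrite krawtchouk_kprod.
under eq_cvg do rewrite krawtchouk_kprod.
apply: (@polyfun_div_cvg _ _ (fun r => poch (- r) (vsum n))) => //.
  exact: polyfun_kprod.
exact/polyfun_poch/polyfunN/polyfun_id.
Qed.

(** The limit is taken term by term.  A term with |k| > N tends to the limit
    prescribed by the convention as soon as some limit exists; the others are
    continuous at N, because (-N)_|k| is nonzero there. *)
Lemma act_n_cvg A (N : R) n x : tame pp A -> admissible N n ->
  (act_x A pp r (fun y => krawtchouk (trunc_index y) x pp r) (real_index R n)
   @[r --> N^'] --> act_n A pp N (fun k r => krawtchouk k x pp r) n)%classic.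
Proof.
move=> [A1 A2 A3] adm; rewrite /act_n /act_x.
apply: (cvg_big (op := +%R)) => [|nu _]; first exact: add_continuous.
set m := shift_index n nu; set k := map_mx absz m.
have coefE r y : A@_nu y pp r = act_x A pp r (fun z => (z == y + int_vec R nu)%:R) y.
  exact: coef_act.
have shiftE : real_index R n + int_vec R nu = map_mx intr m.
  by apply/rowP => i; rewrite !mxE intrD.
(* A shift to an index with a negative component has coefficient 0. *)
case: ifPn => [neg|/negPn/forallP pos].
  have A0 r : A@_nu (real_index R n) pp r = 0.
    rewrite coefE A2 // => k'; case: eqP => // e; case/negP: neg; apply/forallP => i.
    have := congr1 (fun v : 'rV[R]_p => v 0 i) e.
    by rewrite shiftE !mxE => e'; rewrite -(ler_int R) -e' ler0n.
  by under eq_cvg do rewrite A0 mul0r; exact: cvg_cst.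
have kE : real_index R n + int_vec R nu = real_index R k.
  rewrite shiftE; apply/rowP => i; rewrite [LHS]mxE [RHS]mxE [k _ _]mxE.
  by rewrite -{1}(gez0_abs (pos i)).
have ->: krawtchouk (trunc_index (real_index R n + int_vec R nu)) x pp
       = krawtchouk k x pp by rewrite kE trunc_indexK.
have cP : polyfun (fun r => A@_nu (real_index R n) pp r * kprod pp 0 p k x r).
  apply: polyfunM; last exact: polyfun_kprod.
  under [X in polyfun X]funext do rewrite coefE.
  by apply: A1 => z; exact: polyfun_cst.
have termE r : A@_nu (real_index R n) pp r * krawtchouk k x pp r =
    (poch (- r) (vsum k))^-1 * (A@_nu (real_index R n) pp r * kprod pp 0 p k x r).
  by rewrite krawtchouk_kprod; ring.
rewrite (funext termE).
case: ifPn => [/andP[/natrP[d dN] Nk]|Nk].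
  rewrite dN ltr_nat in Nk *.
  apply: polyfun_div_poch_cvg => //.
  rewrite coefE (A3 d) ?mul0r // => [k' k'd|]; last first.
    by move: adm; rewrite dN => /(_ (natr_nat _ _)); rewrite ler_nat.
  rewrite kE; case: eqP => // e.
  suff kk : k' = k by move: Nk; rewrite -kk ltnNge k'd.
  by rewrite -(trunc_indexK R k') e trunc_indexK.
rewrite termE; apply: (@polyfun_div_cvg _ _ (fun r => poch (- r) (vsum k))) => //.
  exact/polyfun_poch/polyfunN/polyfun_id.
apply: admissible_poch_neq0 => Nn.
by rewrite leNgt; move: Nk; rewrite Nn.
Qed.

(** Both sides of an eigenvalue equation are limits, as the size parameter tends
    to N, of the two sides of the same equation for non-integer sizes. *)
Lemma act_n_eigen A (N mu : R) n x : tame pp A -> admissible N n ->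
  (forall r : R, (forall d : nat, r != d%:R) ->
     act_x A pp r (fun y => krawtchouk (trunc_index y) x pp r) (real_index R n)
     = mu * krawtchouk n x pp r) ->
  act_n A pp N (fun k r => krawtchouk k x pp r) n = mu * krawtchouk n x pp N.
Proof.
move=> tA adm eig; have lim1 := act_n_cvg (x := x) tA adm.
apply: (cvg_unique _ lim1); first exact: Rhausdorff.
apply: cvg_trans (cvgM (cvg_cst mu) (krawtchouk_cvg (x := x) adm)).
apply: near_eq_cvg; near=> r; rewrite eig //.
by near: r; exact: near_nonnat.
Unshelve. all: by end_near. Qed.

End IndexAction.

Theorem theorem5p7 (R : realType) (p : nat) (hp : (0 < p)%N)
    (pp : 'rV[R]_p) (N : R)
    (hpp : forall j : 'I_p, pp 0 j != 0)
    (hpsum : forall j : 'I_p, psum pp j.+1 != 1) :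
  (forall A : diffop R p, in_algebra (@Lx R p) A ->
     exists mu : 'rV[nat]_p -> R,
     forall (n : 'rV[nat]_p) (x : 'rV[R]_p), admissible N n ->
       act_x A pp N (fun y => krawtchouk n y pp N) x
       = mu n * krawtchouk n x pp N)
  /\
  (forall A : diffop R p, in_algebra (@Ln R p) A ->
     exists mu : 'rV[R]_p -> R,
     forall (n : 'rV[nat]_p) (x : 'rV[R]_p), admissible N n ->
       act_n A pp N (fun k N' => krawtchouk k x pp N') n
       = mu x * krawtchouk n x pp N)
  /\
  (forall (j : 'I_p) (n : 'rV[nat]_p) (x : 'rV[R]_p), admissible N n ->
     (act_x (Lx R j) pp N (fun y => krawtchouk n y pp N) x
      = (\sum_(i < p | (j <= i)%N) n ord0 i)%:R * krawtchouk n x pp N)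
     /\
     (act_n (Ln R j) pp N (fun k N' => krawtchouk k x pp N') n
      = (\sum_(i < p | (i < p - j)%N) x 0 i) * krawtchouk n x pp N)).
Proof.
split; [|split].
- move=> A; elim=> {A} [a|j|A B _ [a aP] _ [b bP]|A B _ [a aP] _ [b bP]].
  + by exists (fun=> a) => n x _; rewrite act_op_coef.
  + exists (fun n => (\sum_(i < p | (j <= i)%N) n ord0 i)%:R) => n x _.
    exact: Lx_spectral.
  + exists (fun n => a n + b n) => n x adm.
    by rewrite act_xD aP // bP // mulrDl.
  + exists (fun n => a n * b n) => n x adm; rewrite act_x_mul.
    by rewrite (funext (fun y => bP n y adm)) act_xZ aP // mulrA [b n * _]mulrC.
- move=> A algA; have tA : tame pp A by exact: in_algebra_tame algA.
  suff [mu muP] : exists mu : 'rV[R]_p -> R, forall n x r,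
      (forall d : nat, r != d%:R) ->
      act_x A pp r (fun y => krawtchouk (trunc_index y) x pp r) (real_index R n)
      = mu x * krawtchouk n x pp r.
    by exists mu => n x adm; apply: act_n_eigen => // r; exact: muP.
  elim: algA {tA} => {A} [a|j|A B _ [a aP] _ [b bP]|A B algA [a aP] _ [b bP]].
  + by exists (fun=> a) => n x r _; rewrite act_op_coef trunc_indexK.
  + exists (fun x => \sum_(i < p | (i < p - j)%N) x 0 i) => n x r rn.
    exact: Ln_spectral_generic.
  + by exists (fun x => a x + b x) => n x r rn; rewrite act_xD aP // bP // mulrDl.
  + exists (fun x => a x * b x) => n x r rn; rewrite act_x_mul.
    (* [B f] equals [b x * f] at the nonnegative integer points only; this
       suffices, as [A] does not look outside them. *)
    have [_ A2 _] := in_algebra_tame hpsum algA.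
    pose f (y : 'rV[R]_p) := krawtchouk (trunc_index y) x pp r.
    have fB m : act_x B pp r f (real_index R m) - b x * f (real_index R m) = 0.
      by rewrite bP // /f trunc_indexK subrr.
    have := A2 r (fun z => act_x B pp r f z - b x * f z) fB n.
    by rewrite act_x_subZ => /subr0_eq ->; rewrite aP // mulrA [b x * _]mulrC.
move=> j n x adm; split; first exact: Lx_spectral.
apply: act_n_eigen => // [|r rn]; first exact: tame_Ln.
exact: Ln_spectral_generic.
Qed.
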